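(* Let $a,b,c\in\mathbb C$ with $c\notin\mathbb Z$. Then, as power series in $t$ (with $\frac1{1-t}$ and $\frac1{(1-t)^2}$ expanded in non-negative powers of $t$), $$F(a,b,c;t)F(-a,-b-2,-c;t)+\frac{4ab}{c(c-4)}\,t\,F(a+1,b+1,c+1;t)F(-a,-b-2,-c;t)$$ $$+\frac{6(a)_2(b)_2}{(c)_2(c-4)_2}\,t^2\,F(a+2,b+2,c+2;t)F(-a,-b-2,-c;t)$$ $$+\frac{4(a)_3(b)_3}{(c)_3(c-4)_3}\,t^3\,F(a+3,b+3,c+3;t)F(-a,-b-2,-c;t)$$ $$+\frac{(a)_4(b)_4}{(c-4)_8}\,t^4\,F(a+4,b+4,c+4;t)F(-a,-b-2,-c;t)$$ $$+\frac{a\,(b)_3\,(a-c)_5\,(c-b-4)_3}{(c-5)_6\,(c-4)_6}\,t^6\,F(a-c+5,b-c+5,6-c;t)F(-a+c+1,-b+c-1,c+2;t)$$ $$=1+\frac{a(4b-2c+8)}{c(c-4)}\,t+\frac{a(a-b-1)(c-b-4)_3}{(c-4)_5}\,t^2+\frac{a(b)_3(a-b+3c-7)}{(c-4)_5}\,\frac{t^2}{1-t}+\frac{a(b)_3(a+b-c+3)}{(c-4)_5}\,\frac{t^3}{(1-t)^2}.$$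
   Context: $F(a,b,c;t)={}_2F_1(a,b,c;t)=\sum_{n\ge0}\frac{(a)_n(b)_n}{n!\,(c)_n}t^n$ is the Gauss hypergeometric series, with $(a)_n=a(a+1)\cdots(a+n-1)$. *)

(* Defs.v *)
From HB Require Import structures.
From mathcomp Require Import all_boot all_order all_algebra.
From mathcomp Require Import boolp reals complex.

Set Implicit Arguments.
Unset Strict Implicit.
Unset Printing Implicit Defensive.
Import GRing.Theory.
Local Open Scope ring_scope.

(* A record rather than a bare function type, so that [nat -> K] keeps its
   pointwise structures and [fps K] gets the Cauchy product. *)
Record fps (K : Type) := Fps { fcoef : nat -> K }.

Lemma fpsP (K : Type) (f g : fps K) : fcoef f =1 fcoef g <-> f = g.
Proof.
split=> [|-> //]; case: f g => [f] [g] /= fg; congr Fps; exact: funext.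
Qed.

HB.instance Definition _ (K : Type) := gen_eqMixin (fps K).
HB.instance Definition _ (K : Type) := gen_choiceMixin (fps K).

Section FpsRing.
Variable K : comNzRingType.
Implicit Types f g h : fps K.

Definition fps0 : fps K := Fps (fun=> 0).
Definition fps_opp f := Fps (fun n => - fcoef f n).
Definition fps_add f g := Fps (fun n => fcoef f n + fcoef g n).

Fact fps_addA : associative fps_add.
Proof. by move=> f g h; apply/fpsP => n /=; rewrite addrA. Qed.
Fact fps_addC : commutative fps_add.
Proof. by move=> f g; apply/fpsP => n /=; rewrite addrC. Qed.
Fact fps_add0 : left_id fps0 fps_add.
Proof. by move=> f; apply/fpsP => n /=; rewrite add0r. Qed.
Fact fps_addN : left_inverse fps0 fps_opp fps_add.
Proof. by move=> f; apply/fpsP => n /=; rewrite addNr. Qed.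

HB.instance Definition _ :=
  GRing.isZmodule.Build (fps K) fps_addA fps_addC fps_add0 fps_addN.

Definition fps1 : fps K := Fps (fun n => (n == 0%N)%:R).
Definition fps_mul f g :=
  Fps (fun n => \sum_(i < n.+1) fcoef f i * fcoef g (n - i)%N).

Definition fps_trunc m f : {poly K} := \poly_(i < m) fcoef f i.

Lemma coef_fps_trunc m f n : (n < m)%N -> (fps_trunc m f)`_n = fcoef f n.
Proof. by move=> lt_nm; rewrite coef_poly lt_nm. Qed.

Lemma fps_mul_trunc m f g n :
  (n < m)%N -> fcoef (fps_mul f g) n = (fps_trunc m f * fps_trunc m g)`_n.
Proof.
move=> lt_nm; rewrite coefM /=; apply: eq_bigr => i _.
rewrite !coef_fps_trunc ?(leq_ltn_trans _ lt_nm) ?leq_subr //.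
by rewrite -ltnS ltn_ord.
Qed.

Fact fps_mulA : associative fps_mul.
Proof.
move=> f g h; apply/fpsP => n.
transitivity ((fps_trunc n.+1 f * (fps_trunc n.+1 g * fps_trunc n.+1 h))`_n).
  rewrite coefM; apply: eq_bigr => i _.
  by rewrite coef_fps_trunc // (@fps_mul_trunc n.+1) // ltnS leq_subr.
rewrite mulrA coefM; apply: eq_bigr => i _.
by rewrite coef_fps_trunc ?ltnS ?leq_subr // (@fps_mul_trunc n.+1).
Qed.

Fact fps_mulC : commutative fps_mul.
Proof.
by move=> f g; apply/fpsP => n; rewrite !(@fps_mul_trunc n.+1) // mulrC.
Qed.

Fact fps_mul1 : left_id fps1 fps_mul.
Proof.
move=> f; apply/fpsP => n /=; rewrite big_ord_recl /= mul1r subn0.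
by rewrite big1 ?addr0 // => i _; rewrite mul0r.
Qed.

Fact fps_mulDl : left_distributive fps_mul fps_add.
Proof.
move=> f g h; apply/fpsP => n /=; rewrite -big_split /=.
by apply: eq_bigr => i _; rewrite mulrDl.
Qed.

Fact fps_1neq0 : fps1 != 0.
Proof.
by apply/eqP => /fpsP/(_ 0%N) /= /eqP; rewrite oner_eq0.
Qed.

HB.instance Definition _ := GRing.Zmodule_isComNzRing.Build (fps K)
  fps_mulA fps_mulC fps_mul1 fps_mulDl fps_1neq0.

Definition fps_scale (k : K) f := Fps (fun n => k * fcoef f n).

Fact fps_scaleA k l f : fps_scale k (fps_scale l f) = fps_scale (k * l) f.
Proof. by apply/fpsP => n /=; rewrite mulrA. Qed.
Fact fps_scale1 : left_id 1 fps_scale.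
Proof. by move=> f; apply/fpsP => n /=; rewrite mul1r. Qed.
Fact fps_scaleDr : right_distributive fps_scale +%R.
Proof. by move=> k f g; apply/fpsP => n /=; rewrite mulrDr. Qed.
Fact fps_scaleDl f : {morph fps_scale^~ f : k l / k + l}.
Proof. by move=> k l; apply/fpsP => n /=; rewrite mulrDl. Qed.

HB.instance Definition _ := GRing.Zmodule_isLmodule.Build K (fps K)
  fps_scaleA fps_scale1 fps_scaleDr fps_scaleDl.

Fact fps_scaleAl (k : K) f g : k *: (f * g) = k *: f * g.
Proof.
apply/fpsP => n /=; rewrite big_distrr /=.
by apply: eq_bigr => i _; rewrite mulrA.
Qed.

HB.instance Definition _ :=
  GRing.Lmodule_isLalgebra.Build K (fps K) fps_scaleAl.
HB.instance Definition _ := GRing.Lalgebra_isComAlgebra.Build K (fps K).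

Definition fpsX : fps K := Fps (fun n => (n == 1%N)%:R).

Lemma fcoefD f g n : fcoef (f + g) n = fcoef f n + fcoef g n.
Proof. by []. Qed.
Lemma fcoefN f n : fcoef (- f) n = - fcoef f n.
Proof. by []. Qed.
Lemma fcoefZ k f n : fcoef (k *: f) n = k * fcoef f n.
Proof. by []. Qed.
Lemma fcoef1 n : fcoef (1 : fps K) n = (n == 0%N)%:R.
Proof. by []. Qed.
Lemma fcoefM f g n :
  fcoef (f * g) n = \sum_(i < n.+1) fcoef f i * fcoef g (n - i)%N.
Proof. by []. Qed.

Lemma fcoefXM f n : fcoef (fpsX * f) n = if n is m.+1 then fcoef f m else 0.
Proof.
rewrite fcoefM big_ord_recl /= mul0r add0r; case: n => [|n].
  by rewrite big_ord0.
rewrite big_ord_recl /= mul1r subSS subn0 big1 ?addr0 // => i _.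
by rewrite mul0r.
Qed.

End FpsRing.

Arguments fpsX {K}.

Section FpsUnit.
Variable K : comUnitRingType.
Implicit Types f g : fps K.

(* The first [n] coefficients of the inverse of [f], obtained by solving
   [f * g = 1] for one coefficient of [g] at a time. *)
Fixpoint fps_inv_seq f n : seq K :=
  if n is m.+1 then
    let s := fps_inv_seq f m in
    rcons s ((fcoef f 0)^-1 *
             ((m == 0%N)%:R - \sum_(i < m) fcoef f (m - i)%N * s`_i))
  else [::].

Definition fps_unit : pred (fps K) :=
  fun f => fcoef f 0 \is a GRing.unit.

Definition fps_inv f :=
  if fps_unit f then Fps (fun n => (fps_inv_seq f n.+1)`_n) else f.

Lemma size_fps_inv_seq f n : size (fps_inv_seq f n) = n.
Proof. by elim: n => //= n IHn; rewrite size_rcons IHn. Qed.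

Lemma nth_fps_inv_seq f n i :
  (i < n)%N -> (fps_inv_seq f n)`_i = (fps_inv_seq f i.+1)`_i.
Proof.
elim: n => // n IHn; rewrite ltnS leq_eqVlt => /predU1P[-> // | lt_in].
by rewrite -IHn //= nth_rcons size_fps_inv_seq lt_in.
Qed.

Fact fps_mulVf : {in fps_unit, left_inverse 1 fps_inv *%R}.
Proof.
move=> f Uf; have Uf0 : fcoef f 0 \is a GRing.unit by [].
rewrite /fps_inv [fps_unit f]Uf0; apply/fpsP => n.
rewrite fcoefM fcoef1 big_ord_recr /= subnn nth_rcons size_fps_inv_seq.
rewrite ltnn eqxx [X in _ + X]mulrC mulVKr // addrCA -[RHS]addr0; congr (_ + _).
apply/eqP; rewrite subr_eq0; apply/eqP.
apply: eq_bigr => i _; rewrite mulrC; congr (_ * _).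
by rewrite [RHS]nth_fps_inv_seq.
Qed.

Fact fps_unitPl f g : g * f = 1 -> fps_unit f.
Proof.
move=> /fpsP/(_ 0%N); rewrite fcoefM big_ord1 => gf.
by apply/unitrPr; exists (fcoef g 0); rewrite mulrC gf.
Qed.

Fact fps_inv_out : {in [predC fps_unit], fps_inv =1 id}.
Proof. by move=> f /negbTE nUf; rewrite /fps_inv [fps_unit f]nUf. Qed.

HB.instance Definition _ := GRing.ComNzRing_hasMulInverse.Build (fps K)
  fps_mulVf fps_unitPl fps_inv_out.

Lemma fps_unitE f : (f \is a GRing.unit) = (fcoef f 0 \is a GRing.unit).
Proof. by []. Qed.

Lemma unit_1subX : (1 - fpsX : fps K) \is a GRing.unit.
Proof. by rewrite fps_unitE fcoefD fcoefN fcoef1 /= subr0 unitr1. Qed.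

Lemma fcoef_inv_1subX n : fcoef ((1 - fpsX : fps K)^-1) n = 1.
Proof.
suff -> : (1 - fpsX : fps K)^-1 = Fps (fun=> 1) by [].
apply: (mulrI unit_1subX); rewrite divrr ?unit_1subX //.
rewrite mulrBl mul1r; apply/fpsP => -[|m].
  by rewrite fcoefD fcoefN fcoefXM /= subr0.
by rewrite fcoefD fcoefN fcoefXM /= subrr.
Qed.

Lemma fcoef_inv_1subX2 n : fcoef ((1 - fpsX : fps K) ^- 2) n = n.+1%:R.
Proof.
rewrite -exprVn expr2 fcoefM (eq_bigr (fun=> 1)) => [|i _].
  by rewrite sumr_const card_ord.
by rewrite !fcoef_inv_1subX mulr1.
Qed.

End FpsUnit.

Definition poch (K : comNzRingType) (x : K) (n : nat) : K :=
  \prod_(i < n) (x + i%:R).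

(* As division is total, this is the Gauss series only when no [poch c n]
   vanishes, i.e. when [c] is not a non-positive integer. *)
Definition hyp2F1 (K : fieldType) (a b c : K) : fps K :=
  Fps (fun n => poch a n * poch b n / (n`!%:R * poch c n)).

(* Main.v *)
Require Import Defs.
From HB Require Import structures.
From mathcomp Require Import all_boot all_order all_algebra.
From mathcomp Require Import boolp reals complex.
From mathcomp Require Import ring zify.
Import GRing.Theory Num.Theory.
Local Open Scope ring_scope.
Set Implicit Arguments.
Unset Strict Implicit.

(** The coefficients of both sides are compared, and the coefficients of the
    left-hand side are summed by residues.

    The first five terms share the factor [F(-a,-b-2,-c)].  The polynomial
    [n |-> (c - 4 + n)_4], expanded in falling factorials of [n] by the
    Chu-Vandermonde formula, shows that the other factors add up to
    [F(a,b,c-4)] ([hyp2F1_lower]).  So the left-hand side is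
    [F(a,b,c-4) F(-a,-b-2,-c)] plus a multiple of [t^6] times a second product,
    which is built from the other local solutions at [0] of the two
    hypergeometric equations.

    For [n >= 3], the [n]-th coefficient is
    [C = a (b)_3 / (c-4)_5] times the sum of the residues of
      [Phi(x) = (x+a+1-n)_{n-1} (x+b+3-n)_{n-3} / ((x-n)_{n+1} (x+c+1-n)_{n-5})].
    (For [n = 3, 4], the last factor, of negative length [n-5], stands for a
    product in the numerator.)  The poles of [Phi] are simple, and they form two
    arithmetic progressions: [0, ..., n] and [5-c, ..., n-1-c].  In a term of the
    [n]-th coefficient of the first product, [(a)_k] and [(-a)_{n-k}] fuse, up to
    sign, into [a] times a single rising factorial of length [n-1]; the
    parameters [b] and [c] behave in the same way with [(b)_3] and [(c-4)_5] in
    place of [a].  So the term is [C] times the residue of [Phi] at [k]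
    ([residue_regular]).  In the second product the two rising factorials leave a
    gap instead, which the constant in front of [t^6] fills; its terms are [C]
    times the residues at [5-c+i] ([residue_singular]).

    Numerator and denominator of [Phi] are monic of the same degree, so the
    residues add up to the sum of the roots of the denominator minus the sum of
    the roots of the numerator ([sum_residues]).  This is an affine function of
    [n], hence the poles of order one and two at [t = 1] on the right.  For
    [n < 3] the factor [(b)_3] is longer than the product it should divide, and
    the three coefficients are computed directly. *)

(** * Rising factorials *)

Lemma poch0 (K : comNzRingType) (x : K) : poch x 0 = 1.
Proof. exact: big_ord0. Qed.

Lemma pochSl (K : comNzRingType) (x : K) n :
  poch x n.+1 = x * poch (x + 1) n.
Proof.
rewrite /poch big_ord_recl /= addr0; congr (_ * _).
by apply: eq_bigr => i _; rewrite -addrA -mulrS.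
Qed.

Lemma pochD (K : comNzRingType) (x : K) m n :
  poch x (m + n) = poch x m * poch (x + m%:R) n.
Proof.
rewrite /poch big_split_ord; congr (_ * _) => //=.
by apply: eq_bigr => i _; rewrite natrD addrA.
Qed.

(** Reversing the order of the factors, each with its sign changed.  The
    condition characterizes [y] as the opposite of the last factor of [(x)_n]. *)
Lemma poch_reflect (K : comNzRingType) (x y : K) n :
  x + y + n%:R = 1 -> poch y n = (-1) ^+ n * poch x n.
Proof.
move=> xyn; have -> : y = (x + y + n%:R) - n%:R - x by ring.
rewrite {}xyn.
rewrite /poch (reindex_inj rev_ord_inj) /= -[in (-1) ^+ n](card_ord n).
rewrite -prodr_const -big_split /=; apply: eq_bigr => i _.
rewrite subnS -subn1 !natrB ?subn_gt0 //; last exact: ltnW.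
by ring.
Qed.

(** * Non-integral parameters *)

Definition nonint (K : nzRingType) (x : K) := forall m : int, x <> m%:~R.

Lemma nonintD (K : nzRingType) (x : K) (k : int) :
  nonint x -> nonint (x + k%:~R).
Proof.
move=> hx m xk; apply: (hx (m - k)).
by rewrite rmorphB /= -xk addrK.
Qed.

Lemma nonintDn (K : nzRingType) (x : K) n : nonint x -> nonint (x + n%:R).
Proof. exact: (@nonintD _ _ n%:Z). Qed.

Lemma nonintBn (K : nzRingType) (x : K) n : nonint x -> nonint (x - n%:R).
Proof. by move=> /(@nonintD _ _ (- n%:Z)); rewrite rmorphN. Qed.

Lemma nonintN (K : nzRingType) (x : K) : nonint x -> nonint (- x).
Proof. by move=> hx m xm; apply: (hx (- m)); rewrite rmorphN /= -xm opprK. Qed.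

Lemma nonint_poch_neq0 (K : idomainType) (x : K) n :
  nonint x -> poch x n != 0.
Proof.
move=> hx; apply/prodf_neq0 => i _; apply/eqP.
exact: nonintDn hx 0.
Qed.

Arguments nonintDn {K x} n _.
Arguments nonintBn {K x} n _.
Arguments nonint_poch_neq0 {K x} n _.

(** The intervals of shifts [0, k) and [M-l, M) exchange their right ends:
    together they cover the same shifts, with multiplicity, as [0, M) and
    [M-l, k).  When [k < M-l], the last interval is negative and counts as a hole
    [k, M-l) on the other side; truncated subtraction makes one statement of the
    two cases. *)
Lemma poch_glue (K : comNzRingType) (x : K) k l M :
  poch x k * poch (x + M%:R - l%:R) l * poch (x + k%:R) (M - (k + l))
  = poch x M * poch (x + M%:R - l%:R) (k + l - M).
Proof.
have [leM|/ltnW geM] := leqP (k + l) M.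
  rewrite (eqP leM) poch0 mulr1 mulrAC -pochD.
  rewrite -[in RHS](subnK (leq_trans (leq_addl k l) leM)) [RHS]pochD.
  congr (poch _ _ * poch _ _); first by lia.
  by rewrite natrB ?addrA // (leq_trans (leq_addl k l)).
rewrite (eqP geM) poch0 mulr1.
have [leMk|/ltnW lekM] := leqP M k.
  rewrite -[in poch x k](subnKC leMk) pochD -mulrA; congr (_ * _).
  have -> : (k + l - M = l + (k - M))%N by lia.
  by rewrite pochD mulrC subrK.
rewrite -[in poch x M](subnKC lekM) pochD -mulrA; congr (_ * _).
rewrite -[X in poch _ X = _](@subnKC (M - k) l); last by lia.
rewrite addnC pochD mulrC; congr (poch _ _ * poch _ _); last by lia.
by rewrite !natrB; [ring|lia|lia].
Qed.

(** The situation complementary to [poch_glue]: a gap of [g] factors separates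
    the descending run, which ends at [x-g-1], from the ascending one, which
    starts at [x]. *)
Lemma poch_glue_gap (K : comNzRingType) (x : K) k l g :
  poch x k * poch (x - g%:R - l%:R) l * poch (x - g%:R) g
  = poch (x - g%:R - l%:R) (l + g + k).
Proof.
rewrite !pochD subrK natrD.
have -> : x - g%:R - l%:R + (l%:R + g%:R) = x by ring.
by ring.
Qed.

(** * Sums of residues *)

(** Compare the top coefficients in the Lagrange interpolation of [p] at the
    points of [s]. *)
Lemma sum_residues_lt (K : fieldType) (s : seq K) (p : {poly K}) :
  uniq s -> (size p <= size s)%N ->
  \sum_(x <- s) p.[x] / \prod_(y <- s | y != x) (x - y) = p`_(size s).-1.
Proof.
move=> us sp.
pose L x := \prod_(y <- s | y != x) ('X - y%:P).
have Lx x : (L x).[x] = \prod_(y <- s | y != x) (x - y).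
  by rewrite horner_prod; apply: eq_bigr => y _; rewrite !hornerE.
have Lx0 x : (L x).[x] != 0.
  by rewrite Lx prodf_seq_neq0; apply/allP => y _; rewrite subr_eq0 eq_sym implybb.
have Ly x y : x \in s -> y != x -> (L y).[x] = 0.
  move=> xs yx; rewrite horner_prod (big_rem x) //= eq_sym yx !hornerE subrr.
  by rewrite mul0r.
have sizeL x : x \in s -> size (L x) = size s.
  move=> xs; rewrite /L -big_filter size_prod_XsubC size_filter.
  by rewrite -(count_predC (pred1 x) s) count_uniq_mem // xs.
have lcL x : x \in s -> (L x)`_(size s).-1 = 1.
  move=> xs; rewrite -(sizeL x xs); apply/eqP.
  exact: (monic_prod_XsubC _ _ id).
have Dp : p = \sum_(x <- s) (p.[x] / (L x).[x]) *: L x.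
  apply/eqP; rewrite -subr_eq0; apply/eqP.
  apply: (@roots_geq_poly_eq0 _ _ s) => //.
    apply/allP => x xs; rewrite /root hornerD hornerN horner_sum.
    rewrite (bigD1_seq x) //= hornerZ divfK // big1 ?addr0 ?subrr // => y yx.
    by rewrite hornerZ (Ly x) ?mulr0.
  apply: leq_trans (size_polyD _ _) _; rewrite size_polyN geq_max sp /=.
  rewrite big_seq_cond; elim/big_ind: _ => [|q r sq sr|x /andP[xs _]].
  - by rewrite size_poly0.
  - by apply: leq_trans (size_polyD _ _) _; rewrite geq_max sq.
  - by apply: leq_trans (size_scale_leq _ _) _; rewrite sizeL.
rewrite [in RHS]Dp coef_sum !big_seq; apply: eq_bigr => x xs.
by rewrite coefZ lcL // mulr1 Lx.
Qed.

(** The residues of [P / Q], for [P] and [Q] monic of the same degree with roots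
    [t] and [s], are those of [(P - Q) / Q]; [P - Q] has smaller degree, and its
    next coefficient is the difference of the sums of the roots. *)
Lemma sum_residues (K : fieldType) (s t : seq K) :
  uniq s -> size t = size s ->
  \sum_(x <- s) (\prod_(y <- t) (x - y)) / \prod_(y <- s | y != x) (x - y)
  = \sum_(y <- s) y - \sum_(y <- t) y.
Proof.
move=> us st; have [s0|s0] := eqVneq (size s) 0%N.
  by move: st; rewrite s0 => /size0nil ->; rewrite (size0nil s0) !big_nil subrr.
pose P (u : seq K) := \prod_(y <- u) ('X - y%:P).
have Px u x : (P u).[x] = \prod_(y <- u) (x - y).
  by rewrite horner_prod; apply: eq_bigr => y _; rewrite !hornerE.
have Pcoef u : size u = size s -> (P u)`_(size s).-1 = - \sum_(y <- u) y.
  by move=> us'; rewrite -us' coefPn_prod_XsubC ?us'.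
have lcP u : size u = size s -> (P u)`_(size s) = 1.
  move=> <-; have /eqP := monic_prod_XsubC u xpredT id.
  by rewrite /lead_coef size_prod_XsubC.
transitivity ((P t - P s)`_(size s).-1); last first.
  by rewrite coefB !Pcoef // addrC opprK.
rewrite -sum_residues_lt //.
  rewrite !big_seq; apply: eq_bigr => x xs; congr (_ / _).
  by rewrite hornerD hornerN !Px [X in _ - X](big_rem x xs) /= subrr mul0r subr0.
apply/leq_sizeP => j; rewrite leq_eqVlt => /predU1P[<-|sj].
  by rewrite coefB !lcP // subrr.
by rewrite coefB !nth_default ?subrr // size_prod_XsubC ?st.
Qed.

(** The roots of the polynomial [(X + z)_n]. *)
Definition run (K : comNzRingType) (z : K) n : seq K :=
  [seq - (z + i%:R) | i <- iota 0 n].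

Lemma size_run (K : comNzRingType) (z : K) n : size (run z n) = n.
Proof. by rewrite size_map size_iota. Qed.

Lemma big_run (K : comNzRingType) (z : K) n (F : K -> K) :
  \sum_(y <- run z n) F y = \sum_(i < n) F (- (z + i%:R)).
Proof. by rewrite big_map -[n in iota 0 n]subn0 big_mkord. Qed.

Lemma prod_run (K : comNzRingType) (z x : K) n :
  \prod_(y <- run z n) (x - y) = poch (x + z) n.
Proof.
rewrite big_map -[n in iota 0 n]subn0 big_mkord.
by apply: eq_bigr => i _; rewrite opprK addrA.
Qed.

Lemma sum_run (K : numFieldType) (z : K) n :
  \sum_(y <- run z n) y = - (n%:R * z + n%:R * (n%:R - 1) / 2).
Proof.
elim: n => [|n IHn]; first by rewrite big_nil; ring.
rewrite /run -addn1 iotaD map_cat big_cat -/(run z n) IHn /= big_seq1 add0n.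
by rewrite natrD; field.
Qed.

Lemma uniq_run (K : numDomainType) (z : K) n : uniq (run z n).
Proof.
rewrite map_inj_uniq ?iota_uniq // => i j /oppr_inj/addrI/eqP.
by rewrite eqr_nat => /eqP.
Qed.

Lemma run_cat (K : comNzRingType) (z : K) m n :
  run z (m + n) = run z m ++ run (z + m%:R) n.
Proof.
rewrite /run iotaD map_cat; congr (_ ++ _).
rewrite addnC iotaDl -map_comp.
by apply: eq_map => i /=; rewrite natrD addrA.
Qed.

Lemma fact_poch (K : comNzRingType) m : m`!%:R = poch (1 : K) m.
Proof.
elim: m => [|m IHm]; first by rewrite poch0.
by rewrite -[in poch _ _]addn1 pochD -IHm /poch big_ord1 addr0 -mulrS -natrM
  mulnC.
Qed.

(** The derivative of [(X + z)_{i+j+1}] at its root [-(z+j)]. *)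
Lemma prod_run_neq (K : numDomainType) (z : K) i j :
  \prod_(y <- run z (j + i.+1) | y != - (z + j%:R)) (- (z + j%:R) - y)
  = (-1) ^+ j * j`!%:R * i`!%:R.
Proof.
have us := uniq_run z (j + i.+1); move: us.
have -> : run z (j + i.+1)
    = run z j ++ - (z + j%:R) :: run (z + j%:R + 1) i.
  rewrite run_cat -add1n run_cat -cat1s; congr (_ ++ (_ ++ _)).
  by rewrite /run /= addr0.
rewrite cat_uniq /= => /and4P[_].
rewrite negb_or => /andP[x1 _] x2 _.
have rmx r : - (z + j%:R) \notin r ->
    \prod_(y <- r | y != - (z + j%:R)) (- (z + j%:R) - y)
    = \prod_(y <- r) (- (z + j%:R) - y).
  by move=> xr; apply: big_rmcond_in => y yr /negPn/eqP yx; rewrite -yx yr in xr.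
rewrite big_cat big_cons eqxx /= !rmx //.
rewrite !prod_run (fact_poch _ i) (fact_poch _ j).
rewrite -(@poch_reflect _ 1 (- j%:R)); last by ring.
by congr (poch _ _ * poch _ _); ring.
Qed.

(** The sum of residues for the denominator [(X + z1)_N1 (X + z2)_N2].  That
    [z2 - z1] is not an integer makes all the poles simple. *)
Lemma sum_residues_runs (K : numFieldType) (z1 z2 : K) N1 N2 (t : seq K) :
    nonint (z2 - z1) -> size t = (N1 + N2)%N ->
  \sum_(j < N1) (\prod_(y <- t) (- (z1 + j%:R) - y))
     / ((-1) ^+ j * j`!%:R * (N1 - j.+1)`!%:R * poch (z2 - z1 - j%:R) N2)
  + \sum_(j < N2) (\prod_(y <- t) (- (z2 + j%:R) - y))
     / ((-1) ^+ j * j`!%:R * (N2 - j.+1)`!%:R * poch (z1 - z2 - j%:R) N1)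
  = \sum_(y <- run z1 N1) y + \sum_(y <- run z2 N2) y - \sum_(y <- t) y.
Proof.
move=> hz st.
have dis (i j : nat) : - (z1 + i%:R) != - (z2 + j%:R).
  apply/eqP => /oppr_inj ij; apply: (hz (i%:Z - j%:Z)).
  rewrite rmorphB /=; apply/eqP; rewrite -subr_eq0.
  have -> : z2 - z1 - (i%:R - j%:R) = (z2 + j%:R) - (z1 + i%:R) by ring.
  by rewrite ij subrr.
have us : uniq (run z1 N1 ++ run z2 N2).
  rewrite cat_uniq !uniq_run andbT; apply/hasPn => _ /mapP[j _ ->].
  by apply/mapP => -[i _ /esym/eqP]; apply/negP.
rewrite -big_cat -sum_residues //; last by rewrite size_cat !size_run.
rewrite big_cat; congr (_ + _).
  rewrite big_run; apply: eq_bigr => j _; rewrite big_cat /=; congr (_ / (_ * _)).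
    by rewrite -(prod_run_neq z1) addnS -addSn subnKC.
  rewrite big_rmcond_in; first by rewrite prod_run; congr poch; ring.
  by move=> _ /mapP[i _ ->]; rewrite eq_sym dis.
rewrite big_run; apply: eq_bigr => j _; rewrite big_cat /= [X in _ / X]mulrC.
congr (_ / (_ * _)).
  rewrite big_rmcond_in; first by rewrite prod_run; congr poch; ring.
  by move=> _ /mapP[i _ ->]; rewrite dis.
by rewrite -(prod_run_neq z2) addnS -addSn subnKC.
Qed.

(** * Lowering the third parameter *)

(** The Chu-Vandermonde formula, cleared of denominators.  The induction step
    writes [d + n] as [(d + k) + (n - k)] in the [k]-th term: one summand extends
    the rising factorial, the other the falling one. *)
Lemma poch_vandermonde (K : comNzRingType) (d : K) n m :
  poch (d + n%:R) m
  = \sum_(k < m.+1) ('C(m, k) * n ^_ k)%:R * poch (d + k%:R) (m - k).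
Proof.
elim: m d => [|m IHm] d; first by rewrite big_ord1 !poch0 bin0 ffactn0 mulr1.
rewrite pochSl -addrA [_ + 1]addrC addrA IHm big_distrr /=.
have split_nk k : (n ^_ k)%:R * (d + n%:R)
    = (n ^_ k)%:R * (d + k%:R) + (n ^_ k.+1)%:R.
  rewrite ffactnSr natrM; have [kn|nk] := leqP k n.
    by rewrite natrB //; ring.
  by rewrite ffact_small // !mul0r addr0.
transitivity (\sum_(k < m.+1) ('C(m, k) * n ^_ k)%:R
                * poch (d + k%:R) (m.+1 - k)
  + \sum_(k < m.+1) ('C(m, k) * n ^_ k.+1)%:R
                * poch (d + k.+1%:R) (m - k)).
  rewrite -big_split; apply: eq_bigr => k _ /=.
  have km : (k <= m)%N by rewrite -ltnS.
  rewrite subSn // pochSl !(natrM _ 'C(m, k)).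
  have -> : d + 1 + k%:R = d + k.+1%:R by rewrite -natr1; ring.
  have -> : d + k%:R + 1 = d + k.+1%:R by rewrite -natr1; ring.
  have := split_nk k; move: (poch _ _) ('C(m, k)%:R) => p C e.
  transitivity (C * p * ((n ^_ k)%:R * (d + n%:R))); first by ring.
  by rewrite e; ring.
rewrite [RHS]big_ord_recl [X in X + _]big_ord_recl -addrA /=.
rewrite !bin0 !ffactn0 !subn0; congr (_ + _).
rewrite [X in X + _](_ : _ = \sum_(k < m.+1) ('C(m, k.+1) * n ^_ k.+1)%:R
                * poch (d + k.+1%:R) (m - k)).
  rewrite -big_split; apply: eq_bigr => k _ /=.
  by rewrite /bump /= !add1n subSS binS mulnDl natrD mulrDl.
by rewrite [RHS]big_ord_recr /= bin_small // mul0n mul0r addr0.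
Qed.

Lemma fcoef_XnM (K : comNzRingType) (f : fps K) k n :
  fcoef (fpsX ^+ k * f) n = if (k <= n)%N then fcoef f (n - k) else 0.
Proof.
elim: k n => [|k IHk] n; first by rewrite mul1r subn0.
by rewrite exprS -mulrA fcoefXM; case: n => // n; rewrite IHk.
Qed.

Lemma fcoef_Xn (K : comNzRingType) k n :
  fcoef (fpsX ^+ k : fps K) n = (n == k)%:R.
Proof.
rewrite -[_ ^+ k]mulr1 fcoef_XnM fcoef1 subn_eq0 eqn_leq andbC.
by case: leqP.
Qed.

(** [t^k F(a+k,b+k,c+k)] is, up to a constant, [t^k] times the [k]-th derivative
    of [F(a,b,c)], so that its [n]-th coefficient is that of [F(a,b,c)] times a
    falling factorial of [n].  By [poch_vandermonde], the sum multiplies the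
    [n]-th coefficient by [(c-m+n)_m / (c-m)_m], which turns [(c)_n] into
    [(c-m)_n]. *)
Lemma hyp2F1_lower (K : numFieldType) (a b c : K) m : nonint c ->
  hyp2F1 a b (c - m%:R)
  = \sum_(k < m.+1)
      ('C(m, k)%:R * poch a k * poch b k / (poch c k * poch (c - m%:R) k))
      *: (fpsX ^+ k * hyp2F1 (a + k%:R) (b + k%:R) (c + k%:R)).
Proof.
move=> hc; apply/fpsP => n; set d := c - m%:R.
have fact_neq0 j : j`!%:R != 0 :> K by rewrite pnatr_eq0 -lt0n fact_gt0.
have c0 j : poch c j != 0 by exact: nonint_poch_neq0.
have ck0 k j : poch (c + k%:R) j != 0.
  exact: nonint_poch_neq0 _ (nonintDn _ hc).
have d0 j : poch d j != 0 by exact: nonint_poch_neq0 _ (nonintBn _ hc).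
rewrite (big_morph (fun f => fcoef f n) (fun f g => fcoefD f g n) erefl) [LHS]/=.
transitivity (poch a n * poch b n / (n`!%:R * poch c n * poch d m)
              * poch (d + n%:R) m).
  have := pochD d n m; rewrite addnC pochD subrK => dnm.
  have -> : poch (d + n%:R) m = poch d m * poch c n / poch d n.
    by rewrite dnm mulrAC mulfV ?mul1r.
  by field; rewrite fact_neq0 c0 !d0.
rewrite poch_vandermonde mulr_sumr; apply: eq_bigr => k _.
rewrite fcoefZ fcoef_XnM; case: leqP => [kn|nk]; last first.
  by rewrite ffact_small // muln0 mulr0n mul0r !mulr0.
have km : (k <= m)%N by rewrite -ltnS.
have poch_split x : poch x n = poch x k * poch (x + k%:R) (n - k).
  by rewrite -pochD subnKC ?kn.
rewrite -(ffact_fact kn) -[in poch d m](subnKC km) pochD !poch_split /= !natrM.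
have := d0 m; rewrite -{1}(subnKC km) pochD mulf_eq0 negb_or => /andP[_ dk0].
have : (n ^_ k)%:R != 0 :> K by rewrite pnatr_eq0 -lt0n ffact_gt0.
move=> nk0; by field; rewrite !fact_neq0 nk0 c0 ck0 d0 dk0.
Qed.

(** * The two products as sums of residues *)

Section Residues.
Variables (K : numFieldType) (a b c : K).
Hypothesis hc : nonint c.

Let fact_neq0 j : j`!%:R != 0 :> K.
Proof. by rewrite pnatr_eq0 -lt0n fact_gt0. Qed.

(** The numerator of the rational function [Phi] whose residues at the roots of
    [(X - n)_{n+1} (X + c+1-n)_{n-5}] are summed below.  The last factor is
    nontrivial only for [n < 5]; it then replaces the factor [(X + c+1-n)_{n-5}]
    of the denominator. *)
Definition numer n (x : K) :=
  poch (x + (a + 1 - n%:R)) (n - 1) * poch (x + (b + 3 - n%:R)) (n - 3)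
  * poch (x + (c - 4)) (5 - n).

(** The residue of [Phi] at [k].  The parameters [a], [b] and [c-4] call for
    [poch_glue] with [M = 1], [3] and [5]; [3 <= k + l] excludes a hole for the
    first two, which could not be moved to the other side because [a] or [b]
    may be an integer. *)
Lemma residue_regular k l : (3 <= k + l)%N ->
  fcoef (hyp2F1 a b (c - 4)) k * fcoef (hyp2F1 (- a) (- b - 2) (- c)) l
  = a * poch b 3 / poch (c - 4) 5
    * (numer (k + l) k%:R
       / ((-1) ^+ l * l`!%:R * k`!%:R
          * poch (k%:R + (c + 1 - (k + l)%:R)) (k + l - 5))).
Proof.
move=> n3; rewrite /= /numer.
have hd := nonintBn 4 hc.
have s2 : (-1) ^+ l * (-1) ^+ l = 1 :> K by rewrite -exprMn mulrNN mulr1 expr1n.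
have s0 : (-1) ^+ l != 0 :> K by rewrite signr_eq0.
rewrite (@poch_reflect _ (a + 1 - l%:R) (- a)); last by ring.
rewrite (@poch_reflect _ (b + 3 - l%:R) (- b - 2)); last by ring.
rewrite (@poch_reflect _ (c + 1 - l%:R) (- c)); last by ring.
have glueA : _ = poch a 1 * poch (a + 1 - l%:R) _ := poch_glue a k l 1.
have glueB := poch_glue b k l 3.
have glueC := poch_glue (c - 4) k l 5.
move: glueA; rewrite (_ : (1 - (k + l) = 0)%N) ?poch0 ?mulr1; last by lia.
move: glueB; rewrite (_ : (3 - (k + l) = 0)%N) ?poch0 ?mulr1; last by lia.
move=> glueB glueA.
rewrite (_ : poch a 1 = a) in glueA; last by rewrite /poch big_ord1 addr0.
have c1 : c - 4 + 5 = c + 1 by ring.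
rewrite c1 in glueC.
have shift (z : K) : k%:R + (z - (k + l)%:R) = z - l%:R by rewrite natrD; ring.
rewrite !shift [k%:R + (c - 4)]addrC.
have hl : nonint (c + 1 - l%:R) by do 2?[apply: nonintBn]; exact: (nonintDn 1).
have C1 := nonint_poch_neq0 k hd; have C2 := nonint_poch_neq0 l hl.
have C3 := nonint_poch_neq0 (5 - (k + l)) (nonintDn k hd).
have C4 := nonint_poch_neq0 5 hd.
have C5 := nonint_poch_neq0 (k + l - 5) hl.
(* What remains is algebra with the rising factorials as indeterminates. *)
move: glueA glueB glueC C1 C2 C3 C4 C5.
move: (poch a k) (poch b k) (poch (c - 4) k).
move: (poch (a + 1 - _) l) (poch (b + 3 - _) l) (poch (c + 1 - _) l).
move=> qa qb qc pa pb pc.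
move: (poch _ (k + l - 1)) (poch _ (k + l - 3)) (poch _ (k + l - 5)).
move=> ra rb rc; move: (poch _ (5 - (k + l))) (poch (c - 4) 5) (poch b 3).
move=> uc d5 b3 ea eb ec pc0 qc0 uc0 d50 rc0.
have ec' : pc * qc = d5 * rc / uc by rewrite -ec mulfK.
transitivity ((pa * qa) * (pb * qb) * ((-1) ^+ l * (-1) ^+ l)
              / ((-1) ^+ l * l`!%:R * k`!%:R * (pc * qc))).
  by field; rewrite s0 !fact_neq0 pc0 qc0.
rewrite ea eb ec' s2.
by field; rewrite s0 !fact_neq0 uc0 d50 rc0.
Qed.

Definition sing_coef :=
  a * poch b 3 * poch (a - c) 5 * poch (c - b - 4) 3
    / (poch (c - 5) 6 * poch (c - 4) 6).

(** The residue of [Phi] at [5 - c + i].  The gaps filled by [poch_glue_gap] have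
    lengths [5], [3] and [7]; up to sign they are the factors [(a-c)_5],
    [(c-b-4)_3] and [(c-5)_7] of [sing_coef], whose denominator is
    [(c-5)_7 (c-4)_5]. *)
Lemma residue_singular i l : let n := (i + l + 6)%N in
  sing_coef
  * (fcoef (hyp2F1 (a - c + 5) (b - c + 5) (6 - c)) i
     * fcoef (hyp2F1 (- a + c + 1) (- b + c - 1) (c + 2)) l)
  = a * poch b 3 / poch (c - 4) 5
    * (numer n (- (c + 1 - n%:R + l%:R))
       / ((-1) ^+ l * l`!%:R * i`!%:R * poch (- c - 1 - l%:R) n.+1)).
Proof.
move=> n; rewrite /sing_coef /= /numer.
have hd := nonintBn 4 hc.
have s2 : (-1) ^+ l * (-1) ^+ l = 1 :> K by rewrite -exprMn mulrNN mulr1 expr1n.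
have s0 : (-1) ^+ l != 0 :> K by rewrite signr_eq0.
rewrite (@poch_reflect _ (a - c - l%:R) (- a + c + 1)); last by ring.
rewrite (@poch_reflect _ (b - c + 2 - l%:R) (- b + c - 1)); last by ring.
rewrite (@poch_reflect _ (- c - 1 - l%:R) (c + 2)); last by ring.
rewrite (@poch_reflect _ (b - c + 2) (c - b - 4)); last by ring.
rewrite (_ : poch (c - 5) 6 * poch (c - 4) 6
             = - poch (c - 4) 5 * poch (- c - 1) 7); last first.
  by rewrite !pochSl !poch0; ring.
have glueA := poch_glue_gap (a - c + 5) i l 5.
have glueB := poch_glue_gap (b - c + 5) i l 3.
have glueC := poch_glue_gap (6 - c) i l 7.
rewrite (_ : a - c + 5 - 5 = a - c) in glueA; last by ring.
rewrite (_ : b - c + 5 - 3 = b - c + 2) in glueB; last by ring.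
rewrite (_ : 6 - c - 7 = - c - 1) in glueC; last by ring.
rewrite (_ : (5 - n = 0)%N) ?poch0 ?mulr1; last by rewrite /n; lia.
rewrite (_ : (l + 5 + i = n - 1)%N) in glueA; last by rewrite /n; lia.
rewrite (_ : (l + 3 + i = n - 3)%N) in glueB; last by rewrite /n; lia.
rewrite (_ : (l + 7 + i = n.+1)%N) in glueC; last by rewrite /n; lia.
rewrite (_ : - (c + 1 - n%:R + l%:R) + (a + 1 - n%:R) = a - c - l%:R);
  last by ring.
rewrite (_ : - (c + 1 - n%:R + l%:R) + (b + 3 - n%:R) = b - c + 2 - l%:R);
  last by ring.
have hc1 := nonintBn 1 (nonintN hc).
have C1 : poch (6 - c) i != 0.
  by apply: nonint_poch_neq0; rewrite addrC; apply/nonintDn/nonintN.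
have C2 := nonint_poch_neq0 l (nonintBn l hc1).
have C3 := nonint_poch_neq0 7 hc1.
have C4 := nonint_poch_neq0 5 hd.
have C5 := nonint_poch_neq0 n.+1 (nonintBn l hc1).
(* What remains is algebra with the rising factorials as indeterminates. *)
move: glueA glueB glueC C1 C2 C3 C4 C5.
rewrite -[(-1) ^+ 3]signr_odd expr1.
move: (poch (a - c + 5) i) (poch (b - c + 5) i) (poch (6 - c) i).
move: (poch (a - c - _) l) (poch (b - c + 2 - _) l) (poch (- c - 1 - _) l).
move=> qa qb qc pa pb pc.
move: (poch _ n.+1) (poch _ (n - 1)) (poch _ (n - 3)) => rc ra rb.
move: (poch (a - c) 5) (poch (c - 4) 5) (poch (- c - 1) 7) (poch b 3).
move: (poch (b - c + 2) 3) => bc3 a5 d5 c7 b3 ea eb ec pc0 qc0 c70 d50 rc0.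
transitivity (a * b3 * (pa * qa * a5) * (pb * qb * bc3)
              * ((-1) ^+ l * (-1) ^+ l)
              / ((-1) ^+ l * l`!%:R * i`!%:R * d5 * (pc * qc * c7))).
  by field; rewrite s0 !fact_neq0 pc0 qc0 c70 d50.
rewrite ea eb ec s2.
by field; rewrite s0 !fact_neq0 d50 rc0.
Qed.

Definition num_roots n : seq K :=
  run (a + 1 - n%:R) (n - 1) ++ run (b + 3 - n%:R) (n - 3) ++ run (c - 4) (5 - n).

Lemma numerE n x : \prod_(y <- num_roots n) (x - y) = numer n x.
Proof. by rewrite !big_cat /= !prod_run mulrA. Qed.

Lemma sum_roots n : (3 <= n)%N ->
  \sum_(y <- run (- n%:R) n.+1) y + \sum_(y <- run (c + 1 - n%:R) (n - 5)) y
    - \sum_(y <- num_roots n) y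
  = (a - b + 3 * c - 7) + (n%:R - 2) * (a + b - c + 3).
Proof.
move=> n3; rewrite /num_roots !big_cat /= !sum_run -natr1.
have -> : (n - 1)%:R = n%:R - 1 :> K by rewrite natrB //; lia.
have -> : (n - 3)%:R = n%:R - 3 :> K by rewrite natrB //; lia.
case: (leqP 5 n) => [n5|].
  have -> : (5 - n = 0)%N by lia.
  have -> : (n - 5)%:R = n%:R - 5 :> K by rewrite natrB //; lia.
  by field.
move=> n5; have -> : (n - 5 = 0)%N by lia.
have -> : (5 - n)%:R = 5 - n%:R :> K by rewrite natrB //; lia.
by field.
Qed.

(** Both sums run over the index [l] of the second factor, because the pole
    [-(z + l)] of the run starting at [z] belongs to that index. *)
Lemma fcoef_product n : (3 <= n)%N ->
  fcoef (hyp2F1 a b (c - 4) * hyp2F1 (- a) (- b - 2) (- c)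
         + sing_coef *: (fpsX ^+ 6
            * (hyp2F1 (a - c + 5) (b - c + 5) (6 - c)
               * hyp2F1 (- a + c + 1) (- b + c - 1) (c + 2)))) n
  = a * poch b 3 / poch (c - 4) 5
    * ((a - b + 3 * c - 7) + (n%:R - 2) * (a + b - c + 3)).
Proof.
move=> n3; have h : nonint (c + 1 - n%:R - - n%:R).
  by rewrite opprK subrK; exact: nonintDn 1 hc.
rewrite -sum_roots // -(sum_residues_runs h); last first.
  by rewrite /num_roots !size_cat !size_run; lia.
rewrite mulrDr fcoefD fcoefZ fcoef_XnM; congr (_ + _).
  rewrite [hyp2F1 a _ _ * _]mulrC fcoefM mulr_sumr; apply: eq_bigr => l _.
  have ln : (l <= n)%N by rewrite -ltnS.
  rewrite mulrC residue_regular subnK // numerE subSS.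
  have -> : - (- n%:R + l%:R) = (n - l)%:R :> K by rewrite natrB //; ring.
  congr (_ * (_ / (_ * poch _ _))).
  by rewrite natrB //; ring.
case: ifP => [n6|n6]; last first.
  by rewrite (_ : (n - 5 = 0)%N) ?big_ord0 ?mulr0 //; lia.
rewrite [hyp2F1 (a - c + 5) _ _ * _]mulrC fcoefM !mulr_sumr.
rewrite (_ : (n - 5 = (n - 6).+1)%N); last by lia.
apply: eq_bigr => l _.
have ln : (l <= n - 6)%N by rewrite -ltnS.
rewrite [fcoef _ l * _]mulrC residue_singular subnK // subnK //.
rewrite numerE subSS; congr (_ * (_ / (_ * poch _ _))).
by ring.
Qed.

(** The right-hand side is the partial fraction form of the generating function
    of the coefficients in [fcoef_product], corrected in degrees below [3]. *)
Lemma product_identity :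
  let t : fps K := fpsX in
  let F : K -> K -> K -> fps K := @hyp2F1 _ in
  F a b (c - 4) * F (- a) (- b - 2) (- c)
  + sing_coef *: (t ^+ 6 * F (a - c + 5) (b - c + 5) (6 - c)
                  * F (- a + c + 1) (- b + c - 1) (c + 2))
  = 1 + (a * (4 * b - 2 * c + 8) / (c * (c - 4))) *: t
    + (a * (a - b - 1) * poch (c - b - 4) 3 / poch (c - 4) 5) *: t ^+ 2
    + (a * poch b 3 * (a - b + 3 * c - 7) / poch (c - 4) 5)
        *: (t ^+ 2 / (1 - t))
    + (a * poch b 3 * (a + b - c + 3) / poch (c - 4) 5)
        *: (t ^+ 3 / (1 - t) ^+ 2).
Proof.
move=> t F; rewrite -[t ^+ 6 * _ * _]mulrA; apply/fpsP => n; rewrite /t.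
rewrite ![in RHS]fcoefD !fcoefZ !fcoef_XnM fcoef_Xn.
rewrite fcoef_inv_1subX fcoef_inv_1subX2 !fcoef1.
have [n3|] := leqP 3 n.
  rewrite /F fcoef_product // (leq_trans _ n3) //.
  case: n n3 => [|[|[|n]]] // n3; rewrite /= !subSS subn0.
  rewrite !mulr0.
  have := nonint_poch_neq0 5 (nonintBn 4 hc); move: (poch (c - 4) 5) => p p0.
  by field.
have d0 : c != 0 by apply/eqP; exact: hc 0.
have dn k : c - k%:R != 0 by apply/eqP; exact: nonintBn k hc 0.
have d1 := dn 1%N; have d2 := dn 2%N; have d3 := dn 3%N; have d4 := dn 4%N.
(* Put the factors of the denominators in the form of [d0] to [d4]. *)
have e1 : c - 4 + 1 = c - 3 by ring.
have e2 : c - 3 + 1 = c - 2 by ring.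
have e3 : c - 2 + 1 = c - 1%:R by ring.
have e4 : c - 1%:R + 1 = c by ring.
have e5 : - c + 1 = - (c - 1%:R) by ring.
move=> n3; rewrite fcoefD fcoefZ fcoef_XnM fcoefM.
case: n n3 => [|[|[|n]]] // _; rewrite !big_ord_recl big_ord0 /bump /=;
  rewrite ?addn0 ?add1n ?subSS ?subnn ?subn0 ?factS fact0 !pochSl !poch0;
  rewrite ?e1 ?e2 ?e3 ?e4 ?e5.
- by field; rewrite d0 d1 d2 d3 d4.
- by field; rewrite d0 d1 d2 d3 d4.
- by field; rewrite d0 d1 d2 d3 d4.
Qed.

Lemma hyp2F1_lower4 :
  hyp2F1 a b (c - 4) = hyp2F1 a b c
  + (4 * a * b / (c * (c - 4)))
      *: (fpsX * hyp2F1 (a + 1) (b + 1) (c + 1))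
  + (6 * poch a 2 * poch b 2 / (poch c 2 * poch (c - 4) 2))
      *: (fpsX ^+ 2 * hyp2F1 (a + 2) (b + 2) (c + 2))
  + (4 * poch a 3 * poch b 3 / (poch c 3 * poch (c - 4) 3))
      *: (fpsX ^+ 3 * hyp2F1 (a + 3) (b + 3) (c + 3))
  + (poch a 4 * poch b 4 / poch (c - 4) 8)
      *: (fpsX ^+ 4 * hyp2F1 (a + 4) (b + 4) (c + 4)).
Proof.
rewrite (hyp2F1_lower a b 4 hc) !big_ord_recr big_ord0 /= add0r.
rewrite !poch0 !addr0 bin0 !mulr1 invr1 mulr1 mulr1n scale1r expr0 mul1r.
rewrite (pochD (c - 4) 4 4) subrK [poch (c - 4) 4 * _]mulrC mul1r.
by rewrite /poch !big_ord1 !addr0.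
Qed.

(** The identity is purely algebraic, and complex numbers enter only as a field
    of characteristic [0]. *)
Theorem hyp2F1_product_sum :
  let t : fps K := fpsX in
  let F : K -> K -> K -> fps K := @hyp2F1 _ in
  F a b c * F (- a) (- b - 2) (- c)
  + (4 * a * b / (c * (c - 4)))
      *: (t * F (a + 1) (b + 1) (c + 1) * F (- a) (- b - 2) (- c))
  + (6 * poch a 2 * poch b 2 / (poch c 2 * poch (c - 4) 2))
      *: (t ^+ 2 * F (a + 2) (b + 2) (c + 2) * F (- a) (- b - 2) (- c))
  + (4 * poch a 3 * poch b 3 / (poch c 3 * poch (c - 4) 3))
      *: (t ^+ 3 * F (a + 3) (b + 3) (c + 3) * F (- a) (- b - 2) (- c))
  + (poch a 4 * poch b 4 / poch (c - 4) 8)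
      *: (t ^+ 4 * F (a + 4) (b + 4) (c + 4) * F (- a) (- b - 2) (- c))
  + (a * poch b 3 * poch (a - c) 5 * poch (c - b - 4) 3
       / (poch (c - 5) 6 * poch (c - 4) 6))
      *: (t ^+ 6 * F (a - c + 5) (b - c + 5) (6 - c)
            * F (- a + c + 1) (- b + c - 1) (c + 2))
  = 1 + (a * (4 * b - 2 * c + 8) / (c * (c - 4))) *: t
    + (a * (a - b - 1) * poch (c - b - 4) 3 / poch (c - 4) 5) *: t ^+ 2
    + (a * poch b 3 * (a - b + 3 * c - 7) / poch (c - 4) 5)
        *: (t ^+ 2 / (1 - t))
    + (a * poch b 3 * (a + b - c + 3) / poch (c - 4) 5)
        *: (t ^+ 3 / (1 - t) ^+ 2).
Proof.
(* Stated for series only, as a numeral such as [4] in the scalars is a sum too. *)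
have distrD (p q g : fps K) : (p + q) * g = p * g + q * g by exact: mulrDl.
have distrZ k (p f g : fps K) : k *: (p * f) * g = k *: (p * f * g).
  by rewrite -scalerAl.
move=> t F; rewrite -product_identity hyp2F1_lower4.
by rewrite !distrD !distrZ.
Qed.

End Residues.

Theorem lemma5p2 (R : realType) (a b c : R[i])
    (hc : forall m : int, c <> m%:~R) :
  let t : fps R[i] := fpsX in
  let F : R[i] -> R[i] -> R[i] -> fps R[i] := @hyp2F1 _ in
  F a b c * F (- a) (- b - 2) (- c)
  + (4 * a * b / (c * (c - 4)))
      *: (t * F (a + 1) (b + 1) (c + 1) * F (- a) (- b - 2) (- c))
  + (6 * poch a 2 * poch b 2 / (poch c 2 * poch (c - 4) 2))
      *: (t ^+ 2 * F (a + 2) (b + 2) (c + 2) * F (- a) (- b - 2) (- c))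
  + (4 * poch a 3 * poch b 3 / (poch c 3 * poch (c - 4) 3))
      *: (t ^+ 3 * F (a + 3) (b + 3) (c + 3) * F (- a) (- b - 2) (- c))
  + (poch a 4 * poch b 4 / poch (c - 4) 8)
      *: (t ^+ 4 * F (a + 4) (b + 4) (c + 4) * F (- a) (- b - 2) (- c))
  + (a * poch b 3 * poch (a - c) 5 * poch (c - b - 4) 3
       / (poch (c - 5) 6 * poch (c - 4) 6))
      *: (t ^+ 6 * F (a - c + 5) (b - c + 5) (6 - c)
            * F (- a + c + 1) (- b + c - 1) (c + 2))
  = 1 + (a * (4 * b - 2 * c + 8) / (c * (c - 4))) *: t
    + (a * (a - b - 1) * poch (c - b - 4) 3 / poch (c - 4) 5) *: t ^+ 2
    + (a * poch b 3 * (a - b + 3 * c - 7) / poch (c - 4) 5)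
        *: (t ^+ 2 / (1 - t))
    + (a * poch b 3 * (a + b - c + 3) / poch (c - 4) 5)
        *: (t ^+ 3 / (1 - t) ^+ 2).
Proof. exact: hyp2F1_product_sum hc. Qed.
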